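(* Let $\Gamma$, $\mathcal{D}$, $B_\Gamma$, $\xi\in\mathrm{int}(\mathcal{D})$, $\phi_1,\phi_2$ be as described in the context, and suppose that $$\mathrm{ri}(\mathrm{dom}(\phi_1))\cap \mathrm{ri}(\mathrm{dom}(\phi_2))\cap \mathrm{ri}(\mathrm{dom}(\Gamma))\neq\emptyset .$$ Let $(\pi^{(\ell)},v^{(\ell)})$ be the iterates defined by $\pi^{(0)}=\xi$, $v^{(0)}=v^{(-1)}=0$ and, for every integer $\ell>0$, $$\pi^{(\ell)} = \mathrm{Prox}^{B_\Gamma}_{\phi_{[\ell]_2}}\Big(\nabla\Gamma^*\big(\nabla\Gamma(\pi^{(\ell-1)})+v^{(\ell-2)}\big)\Big),\qquad v^{(\ell)} = v^{(\ell-2)}+\nabla\Gamma(\pi^{(\ell-1)})-\nabla\Gamma(\pi^{(\ell)}),$$ where $[\ell]_2=1$ if $\ell$ is odd and $[\ell]_2=2$ if $\ell$ is even. Then $\pi^{(\ell)}$ converges, as $\ell\to+\infty$, to the solution of $$\min_{\pi\in\mathcal{D}}\; B_\Gamma(\pi|\xi)+\phi_1(\pi)+\phi_2(\pi).$$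
   Context: We work in a finite-dimensional Euclidean space with inner product $\langle\cdot,\cdot\rangle$. $\Gamma$ is a strictly convex function with convex domain $\mathcal{D}=\mathrm{dom}(\Gamma)$, smooth on $\mathrm{int}(\mathcal{D})$, such that its Legendre transform $\Gamma^*(\rho)=\max_{\pi\in\mathcal{D}}\langle\pi,\rho\rangle-\Gamma(\pi)$ is also smooth and strictly convex; in particular $\nabla\Gamma$ and $\nabla\Gamma^*$ are mutually inverse bijections between $\mathrm{int}(\mathcal{D})$ and $\mathrm{int}(\mathrm{dom}(\Gamma^* ))$. The Bregman divergence is $$B_\Gamma(\pi|\xi)=\Gamma(\pi)-\Gamma(\xi)-\langle\nabla\Gamma(\xi),\pi-\xi\rangle,\qquad (\pi,\xi)\in\mathcal{D}\times\mathrm{int}(\mathcal{D}).$$ $\phi_1,\phi_2$ are proper, lower-semicontinuous convex functions on $\mathcal{D}$ (with values in $(-\infty,+\infty]$), $\mathrm{dom}(\phi)=\{\pi : \phi(\pi)\neq+\infty\}$, and $\mathrm{ri}$ denotes the relative interior. The proximal map is $$\mathrm{Prox}^{B_\Gamma}_{\phi}(\pi)=\mathrm{argmin}_{\tilde\pi\in\mathcal{D}}\;B_\Gamma(\tilde\pi|\pi)+\phi(\tilde\pi),\qquad \pi\in\mathrm{int}(\mathcal{D}).$$ It is assumed that $\phi=\phi_1,\phi_2$ are coercive, so that this proximal map is always uniquely defined, and it takes values in $\mathrm{int}(\mathcal{D})$; hence the iterates are well defined.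
   Formalization: The iterates are assumed well defined: each argument ∇Γ(π^(ℓ-1))+v^(ℓ-2) lies in int(dom Γ* ). This does not follow from the context: for Γ=exp on ℝ, ξ=0, φ1=5|x+10|, φ2=5|x−10|, it equals −4 at ℓ=4. *)

(* Defs.v *)
From HB Require Import structures.
From mathcomp Require Export all_boot all_order all_algebra.
From mathcomp Require Export all_classical all_reals all_analysis.
Export Order.TTheory GRing.Theory Num.Theory.
Export numFieldNormedType.Exports.

Set Implicit Arguments.
Unset Strict Implicit.
Unset Printing Implicit Defensive.

Local Open Scope classical_set_scope.
Local Open Scope ring_scope.

(* The Euclidean space is 'rV[R]_n with an arbitrary inner product
   [dot : {dot 'rV[R]_n for idfun}], which covers every finite-dimensional
   Euclidean space up to the choice of a basis.  The topology is the one of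
   the library's sup norm, i.e., the usual one.

   A function F with values in ]-oo, +oo] is a map to \bar R, and D always
   stands for a set outside which the values of the functions considered on
   it are irrelevant. *)

Definition effdom (R : realType) (n : nat) (D : set 'rV[R]_n)
    (F : 'rV[R]_n -> \bar R) : set 'rV[R]_n :=
  [set x | D x /\ F x <> +oo%E].

Definition dom (R : realType) (n : nat) (F : 'rV[R]_n -> \bar R) :
  set 'rV[R]_n := effdom setT F.

Definition is_affine (R : realType) (n : nat) (A : set 'rV[R]_n) : Prop :=
  forall (x y : 'rV[R]_n) (t : R), A x -> A y -> A (t *: x + (1 - t) *: y).

Definition affine_hull (R : realType) (n : nat) (A : set 'rV[R]_n) :
  set 'rV[R]_n := smallest (@is_affine R n) A.

Definition ri (R : realType) (n : nat) (A : set 'rV[R]_n) : set 'rV[R]_n :=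
  [set x | A x /\ \forall y \near x, affine_hull A y -> A y].

Definition convex_on (R : realType) (n : nat) (D : set 'rV[R]_n)
    (F : 'rV[R]_n -> \bar R) : Prop :=
  forall (x y : 'rV[R]_n) (t : R), D x -> D y -> 0 < t < 1 ->
    (F (t *: x + (1 - t) *: y)%R <= t%:E * F x + (1 - t)%:E * F y)%E.

Definition strictly_convex (R : realType) (n : nat)
    (F : 'rV[R]_n -> \bar R) : Prop :=
  forall (x y : 'rV[R]_n) (t : R), dom F x -> dom F y -> x <> y -> 0 < t < 1 ->
    (F (t *: x + (1 - t) *: y)%R < t%:E * F x + (1 - t)%:E * F y)%E.

(* Riesz representative of the differential for the inner product [dot];
   meaningful where F is finite near x and differentiable at x. *)
Definition grad (R : realType) (n : nat) (dot : {dot 'rV[R]_n for idfun})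
    (F : 'rV[R]_n -> \bar R) (x : 'rV[R]_n) : 'rV[R]_n :=
  xget 0 [set g | forall h : 'rV[R]_n, 'd (fine \o F) x h = dot g h].

(* "Smooth" in the sense of convex analysis, i.e., C^1. *)
Definition smooth_on_interior (R : realType) (n : nat)
    (dot : {dot 'rV[R]_n for idfun}) (F : 'rV[R]_n -> \bar R) : Prop :=
  forall x : 'rV[R]_n, interior (dom F) x ->
    differentiable (fine \o F) x /\ {for x, continuous (grad dot F)}.

(* A supremum rather than a maximum, so that it is defined for every rho: it
   is attained for rho in the interior of dom (legendre dot Gamma), but need
   not be attained elsewhere. *)
Definition legendre (R : realType) (n : nat) (dot : {dot 'rV[R]_n for idfun})
    (Gamma : 'rV[R]_n -> \bar R) (rho : 'rV[R]_n) : \bar R :=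
  ereal_sup [set ((dot pi rho)%:E - Gamma pi)%E | pi in dom Gamma].

Definition bregman_generator (R : realType) (n : nat)
    (dot : {dot 'rV[R]_n for idfun}) (Gamma : 'rV[R]_n -> \bar R) : Prop :=
  [/\ (forall x : 'rV[R]_n, Gamma x <> -oo%E) /\ convex_set (dom Gamma),
      strictly_convex Gamma,
      smooth_on_interior dot Gamma,
      strictly_convex (legendre dot Gamma) &
      smooth_on_interior dot (legendre dot Gamma)].

Definition bregman (R : realType) (n : nat) (dot : {dot 'rV[R]_n for idfun})
    (Gamma : 'rV[R]_n -> \bar R) (pi xi : 'rV[R]_n) : \bar R :=
  (Gamma pi - Gamma xi - (dot (grad dot Gamma xi) (pi - xi)%R)%:E)%E.

Definition proper_on (R : realType) (n : nat) (D : set 'rV[R]_n)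
    (F : 'rV[R]_n -> \bar R) : Prop :=
  (forall x : 'rV[R]_n, D x -> F x <> -oo%E) /\ effdom D F !=set0.

(* In the topology of [subspace D] the points outside D are isolated, so this
   only constrains F on D, relatively to D. *)
Definition lsc_on (R : realType) (n : nat) (D : set 'rV[R]_n)
    (F : 'rV[R]_n -> \bar R) : Prop :=
  lower_semicontinuous (F : subspace D -> \bar R).

Definition coercive_on (R : realType) (n : nat) (D : set 'rV[R]_n)
    (F : 'rV[R]_n -> \bar R) : Prop :=
  forall M : R, exists r : R,
    forall x : 'rV[R]_n, D x -> r < `|x| -> (M%:E < F x)%E.

Definition argmin (R : realType) (n : nat) (D : set 'rV[R]_n)
    (F : 'rV[R]_n -> \bar R) : set 'rV[R]_n :=
  [set p | D p /\ forall q : 'rV[R]_n, D q -> (F p <= F q)%E].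

Definition prox_argmin (R : realType) (n : nat)
    (dot : {dot 'rV[R]_n for idfun}) (Gamma phi : 'rV[R]_n -> \bar R)
    (pi : 'rV[R]_n) : set 'rV[R]_n :=
  argmin (dom Gamma) (fun q => bregman dot Gamma q pi + phi q)%E.

(* The unique point of [prox_argmin] when [prox_well_defined] holds. *)
Definition prox (R : realType) (n : nat) (dot : {dot 'rV[R]_n for idfun})
    (Gamma phi : 'rV[R]_n -> \bar R) (pi : 'rV[R]_n) : 'rV[R]_n :=
  xget 0 (prox_argmin dot Gamma phi pi).

Definition prox_well_defined (R : realType) (n : nat)
    (dot : {dot 'rV[R]_n for idfun}) (Gamma phi : 'rV[R]_n -> \bar R) : Prop :=
  forall pi : 'rV[R]_n, interior (dom Gamma) pi ->
    exists2 p : 'rV[R]_n,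
      interior (dom Gamma) p & prox_argmin dot Gamma phi pi = [set p].

Definition admissible (R : realType) (n : nat)
    (dot : {dot 'rV[R]_n for idfun}) (Gamma phi : 'rV[R]_n -> \bar R) : Prop :=
  [/\ proper_on (dom Gamma) phi,
      lsc_on (dom Gamma) phi,
      convex_on (dom Gamma) phi,
      coercive_on (dom Gamma) phi &
      prox_well_defined dot Gamma phi].

(* Main.v *)
Require Import Defs.
From mathcomp Require Import ring lra.

(** The iteration is block coordinate ascent on the Fenchel dual of the problem.
    With [eta] the gradient of [Gamma] at [xi], the dual variables [v l] are
    subgradients of the two functions at the iterates (first-order optimality of
    the proximal points, [prox_subgradient], together with the inversion of the
    gradient of [Gamma], [grad_legendre]), and
    [grad dot Gamma (pi l) + v l + v (l - 1) = eta] at every step.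

    Weak duality ([dual_le_primal]) bounds the dual value plus the Bregman
    divergence [B(x | pi l)] by the primal value at [x], and each step increases
    the dual value by at least [B(pi l.+1 | pi l)] ([dual_increase]).  As the
    primal value is finite at a point [x0] of the three relative interiors, the
    dual values converge, the divergences between consecutive iterates tend to
    zero, and [B(x0 | pi l)] is bounded.  The latter bounds the gradients of [Gamma]
    at the iterates ([grad_bounded]).  Perturbing [x0] inside the affine hulls of
    the two domains bounds the dual variables, up to components that never act
    ([bounded_representatives]).

    Bounded gradients do not suffice to bound the iterates, since the domain of the
    conjugate of [Gamma] need not be open.  Coercivity does it ([iterate_cvg]):
    each proximal step starts at a point whose gradient has the form [eta - v m],
    which gives affine minorants of [Gamma] that leave room for the linear growth
    of the convex functions.

    A limit point of the iterates is then interior to the domain of [Gamma],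
    because strict convexity of the conjugate makes [Gamma] steep at the boundary
    ([minorant_point_interior]).  There everything is continuous, consecutive
    iterates have the same limit ([limit_step]), the duality gap closes, and weak
    duality becomes the statement that the limit minimizes the objective, with the
    excess at [x] at least the Bregman divergence from [x] to the limit
    ([limit_optimal]).  The minimizer is therefore unique, and the whole sequence
    converges to it.

    Limits are taken along ultrafilters finer than [\oo]; since the limit does not
    depend on the ultrafilter, the sequence itself converges. *)

Set Implicit Arguments.
Unset Strict Implicit.
Unset Printing Implicit Defensive.
Local Open Scope classical_set_scope.
Local Open Scope ring_scope.

(** * Inner products on row vectors *)

Section InnerProduct.
Context {R : realType} {n : nat} (dot : {dot 'rV[R]_n for idfun}).
Implicit Types x y z h : 'rV[R]_n.

Lemma dotC x y : dot x y = dot y x.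
Proof. by rewrite hermC expr0 mul1r. Qed.

Lemma dotDl x y z : dot (x + y) z = dot x z + dot y z.
Proof. exact: linearDl. Qed.
Lemma dotDr z x y : dot z (x + y) = dot z x + dot z y.
Proof. exact: linearDr. Qed.
Lemma dotNl x z : dot (- x) z = - dot x z.
Proof. exact: linearNl. Qed.
Lemma dotNr z x : dot z (- x) = - dot z x.
Proof. exact: linearNr. Qed.
Lemma dotBl x y z : dot (x - y) z = dot x z - dot y z.
Proof. by rewrite dotDl dotNl. Qed.
Lemma dotBr z x y : dot z (x - y) = dot z x - dot z y.
Proof. by rewrite dotDr dotNr. Qed.
Lemma dotZl (a : R) x z : dot (a *: x) z = a * dot x z.
Proof. by rewrite linearZl_LR. Qed.
Lemma dotZr z (a : R) x : dot z (a *: x) = a * dot z x.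
Proof. by rewrite dotC dotZl dotC. Qed.
Definition dotE := (dotDl, dotDr, dotNl, dotNr).

Lemma dot0l z : dot 0 z = 0.
Proof. by rewrite -(scale0r 0) dotZl mul0r. Qed.
Lemma dot0r z : dot z 0 = 0.
Proof. by rewrite dotC dot0l. Qed.
Lemma dot_gt0 x : x != 0 -> 0 < dot x x.
Proof. exact: neq0_dnorm_gt0. Qed.
Lemma dot_ge0 x : 0 <= dot x x.
Proof. by have [->|/dot_gt0/ltW//] := eqVneq x 0; rewrite dot0l. Qed.
Lemma dot_inj x y : (forall h, dot x h = dot y h) -> x = y.
Proof.
move=> xy; apply/eqP; rewrite -subr_eq0; apply/negPn/negP => /dot_gt0.
by rewrite dotBl xy subrr ltxx.
Qed.

Lemma dot_le_eq x y : (forall h, dot x h <= dot y h) -> x = y.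
Proof.
move=> xy; apply: dot_inj => h; apply/eqP; rewrite eq_le xy/=.
by rewrite -lerN2 -!dotNr xy.
Qed.

Lemma dot_sumr (I : Type) (s : seq I) (F : I -> 'rV[R]_n) z :
  dot z (\sum_(i <- s) F i) = \sum_(i <- s) dot z (F i).
Proof. exact: linear_sumr. Qed.

Lemma gramE (M := \matrix_(i < n, j < n) dot 'e_i 'e_j) (w : 'rV[R]_n) j :
  (w *m M) 0 j = dot w 'e_j.
Proof.
rewrite mxE [in RHS](row_sum_delta w) dotC dot_sumr.
by apply: eq_bigr => i _; rewrite mxE dotZr (dotC 'e_j).
Qed.

(** The Gram matrix of the canonical basis is invertible, because the form is
    definite; solving with it gives the representative. *)
Lemma riesz (l : 'rV[R]_n -> R) :
    (forall (a : R) x y, l (a *: x + y) = a * l x + l y) ->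
  exists w, forall x, l x = dot w x.
Proof.
move=> lin; pose M := \matrix_(i < n, j < n) dot 'e_i 'e_j.
have Mfree : row_free M.
  apply: inj_row_free => v vM0; apply: dot_inj => h; rewrite dot0l.
  rewrite (row_sum_delta h) dot_sumr big1// => j _.
  by rewrite dotZr -gramE -/M vM0 mxE mulr0.
have l0 : l 0 = 0.
  have := lin 1 0 0; rewrite scaler0 addr0 mul1r => /eqP.
  by rewrite -subr_eq0 opprD addrA subrr add0r oppr_eq0 => /eqP.
have lsum (s : seq 'I_n) (F : 'I_n -> 'rV[R]_n) (a : 'I_n -> R) :
    l (\sum_(i <- s) a i *: F i) = \sum_(i <- s) a i * l (F i).
  by elim: s => [|i s IH]; rewrite ?big_nil// !big_cons lin IH.
exists ((\row_j l 'e_j) *m invmx M) => x.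
rewrite (row_sum_delta x) lsum dot_sumr; apply: eq_bigr => j _.
by rewrite dotZr -gramE -mulmxA mulVmx -?row_free_unit// mulmx1 mxE.
Qed.

Lemma rV_norm_le x (C : R) : 0 <= C -> (forall i, `|x 0 i| <= C) -> `|x| <= C.
Proof.
move=> C0 xC; rewrite /Num.norm/= mx_normrE.
by apply: bigmax_le => // -[i j] _ /=; rewrite ord1.
Qed.

Lemma rV_coord_le x i : `|x 0 i| <= `|x|.
Proof.
rewrite [leRHS]/Num.norm/= mx_normrE.
by apply/bigmax_geP; right; exists (0, i).
Qed.

Lemma dot_bounded :
  exists2 K, 0 < K & forall x y, `|dot x y| <= K * (`|x| * `|y|).
Proof.
exists (1 + \sum_(i < n) \sum_(j < n) `|dot 'e_i 'e_j|) => [|x y].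
  by rewrite ltr_pwDl// sumr_ge0// => i _; rewrite sumr_ge0.
rewrite mulrDl mul1r ler_wpDl ?mulr_ge0//.
rewrite [in leLHS](row_sum_delta x) dotC dot_sumr.
rewrite (le_trans (ler_norm_sum _ _ _))// mulr_suml ler_sum// => i _.
rewrite dotZr normrM [in leLHS](row_sum_delta y) dotC dot_sumr mulr_suml.
rewrite (le_trans (ler_wpM2l _ (ler_norm_sum _ _ _)))// mulr_sumr ler_sum//.
move=> j _; rewrite dotZr normrM mulrA mulrC ler_wpM2l//.
by rewrite ler_pM// rV_coord_le.
Qed.

Lemma cvg_dot (T : Type) (F : set_system T) {FF : Filter F}
    (f g : T -> 'rV[R]_n) x y :
  f @ F --> x -> g @ F --> y -> (fun t => dot (f t) (g t)) @ F --> dot x y.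
Proof.
move=> fx gy; have [K K0 dotK] := dot_bounded.
have fx0 : `|f t - x| @[t --> F] --> (0 : R).
  rewrite -(@normr0 _ 'rV[R]_n) -(subrr x).
  by apply: cvg_norm; apply: cvgB => //; exact: cvg_cst.
have gy0 : `|g t - y| @[t --> F] --> (0 : R).
  rewrite -(@normr0 _ 'rV[R]_n) -(subrr y).
  by apply: cvg_norm; apply: cvgB => //; exact: cvg_cst.
apply/cvgrPdist_le => e e0.
have : K * (`|f t - x| * `|g t|) + K * (`|x| * `|g t - y|) @[t --> F] --> (0 : R).
  rewrite -[0](_ : K * (0 * `|y|) + K * (`|x| * 0) = 0); last first.
    by rewrite mul0r !mulr0 addr0.
  apply: cvgD; (apply: cvgM; first exact: cvg_cst); apply: cvgM => //.
    exact: cvg_norm.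
  exact: cvg_cst.
move=> /cvgrPdist_le /(_ e e0); apply: filterS => t.
rewrite sub0r normrN => /(le_trans (ler_norm _)); apply: le_trans.
rewrite distrC.
have -> : dot (f t) (g t) - dot x y = dot (f t - x) (g t) + dot x (g t - y).
  by rewrite dotBl dotBr addrA subrK.
by rewrite (le_trans (ler_normD _ _))// lerD.
Qed.

(** Each coordinate of a vector is its inner product with a fixed vector, so
    boundedness can be tested one direction at a time.  Gradients, dual variables
    and almost optimal points all satisfy an inequality that controls their
    product with a given direction. *)
Lemma weakly_bounded (I : Type) (A : set I) (f : I -> 'rV[R]_n) :
    (forall h, exists C, forall i, A i -> dot (f i) h <= C) ->
  exists2 C, 0 <= C & forall i, A i -> `|f i| <= C.
Proof.
move=> fA.
have /choice[w wE] : forall j : 'I_n, exists w, forall x, x 0 j = dot w x.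
  by move=> j; apply: riesz => a x y; rewrite !mxE.
have /choice[C fC] : forall j : 'I_n, exists C, forall i, A i -> `|f i 0 j| <= C.
  move=> j; have [C1 fC1] := fA (w j); have [C2 fC2] := fA (- w j).
  exists (Num.max C1 C2) => i Ai; rewrite ler_norml wE dotC le_max fC1//.
  rewrite andbT lerNl le_max; apply/orP; right.
  by rewrite -dotNr fC2.
exists (\big[Order.max/0]_j C j) => [|i Ai]; first exact: bigmax_ge_id.
apply: rV_norm_le => [|j]; first exact: bigmax_ge_id.
by apply/bigmax_geP; right; exists j => //; exact: fC.
Qed.
End InnerProduct.

(** A matrix of maximal rank among those whose row space lies in [L] has row
    space exactly [L]; composing it with its partial inverse projects on [L]. *)
Lemma subspace_projector {R : realType} {n : nat} (L : set 'rV[R]_n) :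
    L 0 -> (forall x y, L x -> L y -> L (x + y)) ->
    (forall (a : R) x, L x -> L (a *: x)) ->
  exists M : 'M[R]_n, forall x, L (x *m M) /\ (L x -> x *m M = x).
Proof.
move=> L0 LD LZ.
pose P (k : nat) :=
  `[< exists A : 'M[R]_n, (forall x, L (x *m A)) /\ \rank A = k >].
have P0 : exists k, P k.
  by exists 0; apply/asboolP; exists 0; split=> [x|]; rewrite ?mulmx0 ?mxrank0.
have Pn k : P k -> (k <= n)%N.
  by move=> /asboolP[A [_ <-]]; exact: rank_leq_row.
have [k /asboolP[A [LA rA]] kmax] := ex_maxnP P0 Pn.
exists (pinvmx A *m A) => x; split=> [|Lx]; first by rewrite mulmxA.
rewrite mulmxA mulmxKpV//.
pose B := (A + x)%MS.
have LB y : L (y *m B).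
  have : (y *m B <= A + x)%MS by exact: submxMl.
  move=> /sub_addsmxP[[u v] /= ->]; apply: LD => //.
  by rewrite (mx11_scalar v) mul_scalar_mx; exact: LZ.
have rB : (\rank B <= \rank A)%N.
  by rewrite rA; apply: kmax; apply/asboolP; exists B.
have AB : (A <= B)%MS by exact: addsmxSl.
have := mxrank_leqif_sup AB; move=> /leqifP; case: ifP => [BA _|_].
  by rewrite (submx_trans _ BA)// addsmxSr.
by rewrite ltnNge rB.
Qed.

(** * Limits along ultrafilters *)

Lemma fmap_ultra (T U : Type) (f : T -> U) (F : set_system T) :
  UltraFilter F -> UltraFilter (f @ F).
Proof.
move=> UF; have PF : ProperFilter F by exact: ultra_proper.
apply: Build_UltraFilter => G PG FG; apply/seteqP; split=> [A GA|]; last exact: FG.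
have [//|FC] := in_ultra_setVsetC (f @^-1` A) UF.
have /FG GC : (f @ F) (~` A) by [].
by case: (@filter_not_empty _ G PG); rewrite -(setICr A); exact: filterI.
Qed.

Section UltrafilterLimits.
Context {T : Type} (U : set_system T) {UU : UltraFilter U}.

(** Since every bounded sequence converges along an ultrafilter on the indices,
    compactness arguments need no nested extraction of subsequences. *)
Lemma ultra_cvg_rV {R : realType} {n : nat} (f : T -> 'rV[R]_n) (C : R) :
  (\forall t \near U, `|f t| <= C) -> exists x : 'rV[R]_n, f @ U --> x.
Proof.
move=> fC; have PU : ProperFilter U by exact: ultra_proper.
have : compact [set x : 'rV[R]_n | `|x| <= C].
  apply: bounded_closed_compact.
    exists C; split; first exact: num_real.
    by move=> M CM x /= /le_trans; apply; exact: ltW.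
  rewrite (_ : [set x | _] = (fun x => `|x|) @^-1` [set r | r <= C])//.
  by apply: closed_comp => [x _|]; [exact: norm_continuous|exact: closed_le].
rewrite compact_ultra => /(_ _ (fmap_ultra f UU)).
by move=> /(_ fC)[x [_ ?]]; exists x.
Qed.

Lemma ultra_cvg_real {R : realType} (f : T -> R) (a b : R) :
  (\forall t \near U, a <= f t <= b) -> exists x : R, f @ U --> x.
Proof.
move=> fC; have PU : ProperFilter U by exact: ultra_proper.
have := @segment_compact R a b.
rewrite compact_ultra => /(_ _ (fmap_ultra f UU)).
have : (f @ U) `[a, b]%classic.
  by apply: filterS fC => t; rewrite /= in_itv.
by move=> /[swap] /[apply] -[x [_ ?]]; exists x.
Qed.

End UltrafilterLimits.

(** A set outside the image of [F] would, together with [F], generate an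
    ultrafilter that avoids it. *)
Lemma ultra_cvg {T : Type} (X : topologicalType) (F : set_system T)
    (f : T -> X) (x : X) :
    ProperFilter F ->
    (forall U, UltraFilter U -> F `<=` U -> f @ U --> x) ->
  f @ F --> x.
Proof.
move=> PF fU A xA; apply: contrapT => FA.
have PFA : ProperFilter (within (~` (f @^-1` A)) F).
  split; last exact: within_filter.
  rewrite /within/= => FA0; apply: FA; apply: filterS FA0 => t /= nA.
  exact: contrapT.
have [U [UU FU]] := ultraFilterLemma PFA.
have PU : ProperFilter U by exact: ultra_proper.
have UA : U (f @^-1` A).
  by apply: fU => // B FB; apply: FU; apply: filterS FB => t.
have UCA : U (~` (f @^-1` A)).
  by apply: FU; rewrite /within/=; exact: filterE.
case: (@filter_not_empty _ U PU).
by rewrite -(setICr (f @^-1` A)); exact: filterI.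
Qed.

Lemma nat_ultrafilter : exists U : set_system nat, UltraFilter U /\ \oo `<=` U.
Proof. exact: ultraFilterLemma. Qed.

(** * Supporting hyperplanes *)

Section Separation.
Context {R : realType} {n : nat} (dot : {dot 'rV[R]_n for idfun}).
Context (D : set 'rV[R]_n).
Hypothesis convexD : forall x y (t : R), D x -> D y -> 0 < t < 1 ->
  D (t *: x + (1 - t) *: y).
Implicit Types x y z p h : 'rV[R]_n.

(** The vector from [p] to its nearest point of the closure of [D], taken as a
    limit of a minimizing sequence, makes a nonnegative product with all [x - p];
    [w] is its opposite, normalized.  The distance in the hypothesis is for the
    sup norm, while the nearest point is for the inner product. *)
Lemma separation_at_distance p (d : R) : D !=set0 -> 0 < d ->
    (forall z, D z -> d <= `|z - p|) ->
  exists2 w, `|w| = 1 & forall x, D x -> dot w (x - p) <= 0.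
Proof.
move=> [x0 Dx0] d0 dD.
pose N z := dot (z - p) (z - p).
pose m := inf (N @` D).
have Nlb z : D z -> m <= N z.
  by move=> Dz; apply: ge_inf; [exists 0 => _ [y _ <-]; exact: dot_ge0|exists z].
have /choice[z zP] : forall k : nat, exists z, D z /\ N z <= m + k.+1%:R^-1.
  move=> k.
  have Ninf : has_inf (N @` D).
    by split; [exists (N x0); exists x0|exists 0 => _ [y _ <-]; exact: dot_ge0].
  have k0 : 0 < k.+1%:R^-1 :> R by rewrite invr_gt0.
  have [_ [y Dy <-] Ny] := inf_adherent k0 Ninf.
  by exists y; split=> //; exact: ltW.
have [U [UU ooU]] := nat_ultrafilter.
have PU : ProperFilter U by exact: ultra_proper.
have [C _ zC] : exists2 C, 0 <= C & forall k, setT k -> `|z k - p| <= C.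
  apply: (weakly_bounded (dot := dot)) => h; exists ((m + 1 + dot h h) / 2) => k _.
  have [_ zk] := zP k.
  have k1 : k.+1%:R^-1 <= 1 :> R by rewrite invf_le1// ler1n.
  move: zk; rewrite /N; move: (z k - p) => a zk.
  have := dot_ge0 dot (a - h); rewrite dotBl !dotBr (dotC _ h a).
  move: (k.+1%:R^-1) zk k1 => c zk k1; lra.
have [w wE] : exists w : 'rV[R]_n, z k - p @[k --> U] --> w.
  by apply: (ultra_cvg_rV (C := C)); apply: nearW => k; exact: zC.
have dw : d <= `|w|.
  apply: (ler_cvg_to (cvg_cst d) (cvg_norm wE)); apply: nearW => k.
  by apply: dD; have [] := zP k.
have w0 : w != 0 by rewrite -normr_gt0 (lt_le_trans d0).
have minw x (t : R) : D x -> 0 < t < 1 ->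
    dot w w <= dot (w + t *: (x - p - w)) (w + t *: (x - p - w)).
  move=> Dx t01.
  have c2 : z k - p + t *: (x - p - (z k - p)) @[k --> U] --> w + t *: (x - p - w).
    by apply: cvgD => //; apply: cvgZr; apply: cvgB => //; exact: cvg_cst.
  have c3 : (k.+1%:R^-1 : R) @[k --> U] --> (0 : R).
    by apply: cvg_trans (@cvg_harmonic R); exact: cvg_app.
  have := ler_cvg_to (cvg_dot (dot := dot) wE wE)
    (cvgD (cvg_dot (dot := dot) c2 c2) c3).
  rewrite addr0; apply.
  apply: nearW => k; have [Dz zk] := zP k.
  rewrite (le_trans zk)// lerD2r.
  have -> : z k - p + t *: (x - p - (z k - p)) = t *: x + (1 - t) *: z k - p.
    by apply/rowP => j; rewrite !mxE; ring.
  by apply: Nlb; exact: convexD.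
exists (- (`|w|^-1 *: w)) => [|x Dx].
  by rewrite normrN normrZ normfV normr_id mulVf// normr_eq0.
rewrite dotNl dotZl oppr_le0 mulr_ge0//.
suff : 0 <= dot w (x - p - w).
  by rewrite dotBr subr_ge0; apply: le_trans; exact: dot_ge0.
set e := x - p - w in minw *; rewrite leNgt; apply/negP => we.
have e0 := dot_ge0 dot e.
(* A step small enough for the linear term of
   [dot (w + t *: e) (w + t *: e)] to dominate the quadratic one. *)
pose t := Num.min (1 / 2) (- dot w e / (1 + dot e e)).
have t0 : 0 < t by rewrite lt_min; apply/andP; split; [lra|rewrite divr_gt0//; lra].
have t1 : t < 1 by rewrite gt_min; apply/orP; left; lra.
have te : t * dot e e <= - dot w e.
  apply: (@le_trans _ _ (- dot w e / (1 + dot e e) * dot e e)).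
    by rewrite ler_wpM2r// ge_min lexx orbT.
  rewrite mulrAC ler_pdivrMr; last lra.
  by rewrite mulrDr mulr1 lerDr; lra.
have := minw x t Dx; rewrite t0 t1 => /(_ isT).
rewrite -/e dotDl !dotDr !dotZl !dotZr (dotC _ e w).
have : t * (t * dot e e) <= t * - dot w e by rewrite ler_wpM2l// ltW.
have : t * dot w e < 0 by rewrite pmulr_rlt0.
lra.
Qed.

(** The points [q k] are obtained by pushing [p] slightly away from [x0]; if one
    of them were adherent to [D], then [p], between it and the interior point
    [x0], would be interior.  So they are separated from [D], and the unit normals
    accumulate at a normal at [p]. *)
Lemma supporting_normal x0 p : interior D x0 -> ~ interior D p ->
  exists2 w, w != 0 & forall x, D x -> dot w (x - p) <= 0.
Proof.
move=> Dx0 Dp.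
have D0 : D !=set0 by exists x0; exact: interior_subset.
have [r /= r0 rD] : exists2 r : R, 0 < r & forall y, `|x0 - y| < r -> D y.
  move/nbhs_ballP : Dx0 => [r r0 rD]; exists r => // y.
  by rewrite -ball_normE in rD; exact: rD.
pose s (k : nat) : R := k.+1%:R^-1.
have s0 k : 0 < s k by rewrite invr_gt0.
pose q k := p + s k *: (p - x0).
have far k z : D z -> s k * r / 2 <= `|z - q k|.
  move=> Dz; rewrite leNgt; apply/negP => zq; apply: Dp.
  apply/nbhs_ballP; exists (s k * r / (2 * (1 + s k))) => /=.
    by rewrite !divr_gt0 ?mulr_gt0//; have := s0 k; lra.
  move=> y; rewrite -ball_normE/= => yp.
  (* The point such that [y] lies on the segment from [z] to [x]. *)
  pose x := (s k)^-1 *: ((1 + s k) *: y - z).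
  have sk0 := s0 k; have skn0 : s k != 0 by rewrite gt_eqF.
  have sk1 : 1 + s k != 0 by rewrite gt_eqF//; lra.
  have Dx : D x.
    apply: rD; rewrite distrC.
    have -> : x - x0 = (s k)^-1 *: ((1 + s k) *: (y - p) - (z - q k)).
      by apply/rowP => j; rewrite !mxE; field.
    rewrite normrZ gtr0_norm ?invr_gt0// mulrC ltr_pdivrMr//.
    rewrite (le_lt_trans (ler_normB _ _))// normrZ gtr0_norm; last lra.
    move: yp; rewrite distrC ltr_pdivlMr; last lra.
    move: zq; lra.
  have -> : y = (1 + s k)^-1 *: z + (1 - (1 + s k)^-1) *: x.
    by apply/rowP => j; rewrite !mxE; field; rewrite skn0 sk1.
  apply: convexD => //; rewrite invr_gt0 invf_lt1; lra.
have /choice[w wP] k : exists w, `|w| = 1 /\ forall x, D x -> dot w (x - q k) <= 0.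
  have d0 : 0 < s k * r / 2 by rewrite divr_gt0// mulr_gt0.
  by have [w w1 wD] := separation_at_distance D0 d0 (far k); exists w.
have [U [UU ooU]] := nat_ultrafilter.
have PU : ProperFilter U by exact: ultra_proper.
have [v vE] : exists v : 'rV[R]_n, w k @[k --> U] --> v.
  by apply: (ultra_cvg_rV (C := 1)); apply: nearW => k; have [->] := wP k.
exists v => [|x Dx].
  suff v1 : (1 : R) <= `|v| by rewrite -normr_gt0 (lt_le_trans _ v1).
  apply: (ler_cvg_to (cvg_cst (1 : R)) (cvg_norm vE)); apply: nearW => k.
  by have [->] := wP k.
have qp : q k @[k --> U] --> p.
  rewrite -[X in _ --> X]addr0; apply: cvgD; first exact: cvg_cst.
  rewrite -[X in _ --> X](scale0r (p - x0)); apply: cvgZl.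
  by apply: cvg_trans (@cvg_harmonic R); exact: cvg_app.
apply: ler_cvg_to (cvg_dot vE (cvgB (cvg_cst x) qp)) (cvg_cst 0) _.
by apply: nearW => k; have [_] := wP k; exact.
Qed.

End Separation.

(** * Gradients and one-sided slopes *)

Section Gradient.
Context {R : realType} {n : nat} (dot : {dot 'rV[R]_n for idfun}).
Context (F : 'rV[R]_n -> \bar R).
Hypothesis smoothF : smooth_on_interior dot F.
Implicit Types x y h g : 'rV[R]_n.

Lemma diff_grad x : interior (dom F) x ->
  forall h, 'd (fine \o F) x h = dot (grad dot F x) h.
Proof.
move=> Dx; rewrite /grad; case: xgetP => [g _ //|no].
have [w wE] : exists w, forall h, 'd (fine \o F) x h = dot w h.
  by apply: riesz => a u v; rewrite linearP.
by case: (no w).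
Qed.

Lemma grad_slope x h : interior (dom F) x ->
  t^-1 * (fine (F (x + t *: h)) - fine (F x)) @[t --> 0^'+]
    --> dot (grad dot F x) h.
Proof.
move=> Dx; have [dF _] := smoothF Dx.
have := diff_derivable (v := h) dF; rewrite /derivable => /cvg_ex[/= l hl].
have lE : l = dot (grad dot F x) h.
  by rewrite -diff_grad// -deriveE//; apply/esym/cvg_lim.
move: hl; rewrite lE => hl.
have : (fun t => t^-1 *: ((fine \o F \o shift x) (t *: h) - (fine \o F) x)) t
    @[t --> 0^'+] --> dot (grad dot F x) h.
  exact: cvg_dnbhs_at_right.
move=> c; apply: cvg_trans c; apply: near_eq_cvg; apply: nearW => t /=.
by rewrite (addrC x).
Qed.

Lemma le_grad x h (c : R) : interior (dom F) x ->
    (\forall t \near 0^'+, t * c <= fine (F (x + t *: h)) - fine (F x)) ->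
  c <= dot (grad dot F x) h.
Proof.
move=> Dx hc; apply: ler_cvg_to (cvg_cst c) (grad_slope (h := h) Dx) _.
near=> t; have t0 : 0 < t by near: t; exact: nbhs_right_gt.
rewrite ler_pdivlMl//; near: t; exact: hc.
Unshelve. all: by end_near. Qed.

Lemma ge_grad x h (c : R) : interior (dom F) x ->
    (\forall t \near 0^'+, fine (F (x + t *: h)) - fine (F x) <= t * c) ->
  dot (grad dot F x) h <= c.
Proof.
move=> Dx hc; apply: ler_cvg_to (grad_slope (h := h) Dx) (cvg_cst c) _.
near=> t; have t0 : 0 < t by near: t; exact: nbhs_right_gt.
rewrite ler_pdivrMl//; near: t; exact: hc.
Unshelve. all: by end_near. Qed.

End Gradient.

Lemma near_line {R : realType} {n : nat} (A : set 'rV[R]_n) x h :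
  interior A x -> \forall t \near (0 : R)^'+, A (x + t *: h).
Proof.
move=> Ax.
have c : x + t *: h @[t --> (0 : R)^'+] --> x.
  rewrite -[X in _ --> X]addr0; apply: cvgD; first exact: cvg_cst.
  rewrite -[X in _ --> X](scale0r h); apply: cvgZl.
  exact: cvg_within.
exact: c.
Qed.

(** * Subgradients of the generator, and its steepness at the boundary *)

Lemma combination_same {R : realType} {n : nat} (x : 'rV[R]_n) (t : R) :
  t *: x + (1 - t) *: x = x.
Proof. by rewrite -scalerDl addrC subrK scale1r. Qed.

Section BregmanGenerator.
Context {R : realType} {n : nat} (dot : {dot 'rV[R]_n for idfun}).
Context (Gamma : 'rV[R]_n -> \bar R).
Hypothesis genG : bregman_generator dot Gamma.
Implicit Types x y h p rho : 'rV[R]_n.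
Let D := dom Gamma.
Let G := fine \o Gamma.

Lemma dom_fin x : D x -> Gamma x = (G x)%:E.
Proof.
move=> [_ xoo]; have [[nGoo _] _ _ _ _] := genG.
by rewrite /G/= fineK// fin_numE; apply/andP; split; apply/eqP.
Qed.

Lemma dom_convex x y (t : R) : D x -> D y -> 0 < t < 1 ->
  D (t *: x + (1 - t) *: y).
Proof.
move=> Dx Dy t01; have [xy|xy] := eqVneq x y.
  by rewrite xy combination_same.
have [_ sG _ _ _] := genG.
have := sG x y t Dx Dy (elimN eqP xy) t01.
by rewrite (dom_fin Dx) (dom_fin Dy) => /ltW h; split=> // e; rewrite e in h.
Qed.

Lemma strict_convexity x y (t : R) : D x -> D y -> x <> y -> 0 < t < 1 ->
  G (t *: x + (1 - t) *: y) < t * G x + (1 - t) * G y.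
Proof.
move=> Dx Dy xy t01; have [_ sG _ _ _] := genG.
have := sG x y t Dx Dy xy t01.
rewrite (dom_fin Dx) (dom_fin Dy) (dom_fin (dom_convex Dx Dy t01)).
by rewrite -!EFinM lte_fin.
Qed.

Lemma strict_subgradient x y : interior D x -> D y -> y <> x ->
  dot (grad dot Gamma x) (y - x) < G y - G x.
Proof.
move=> Dx Dy yx; have [_ _ smG _ _] := genG.
have Dx' : D x by exact: interior_subset.
(* The large inequality at the midpoint and strict convexity between it and the
   endpoints give the strict one. *)
pose z := 2^-1 *: y + (1 - 2^-1) *: x.
have half : 0 < (2^-1 : R) < 1 by apply/andP; split; lra.
have Dz : D z by exact: dom_convex.
have Gz : G z < 2^-1 * G y + (1 - 2^-1) * G x by exact: strict_convexity.
have zx : z - x = 2^-1 *: (y - x) by apply/rowP => j; rewrite !mxE; field.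
suff : dot (grad dot Gamma x) (z - x) <= G z - G x.
  rewrite zx dotZr; lra.
apply: (ge_grad smG) => //.
near=> t.
have t0 : 0 < t by near: t; exact: nbhs_right_gt.
have t1 : t < 1 by near: t; exact: nbhs_right_lt.
have -> : x + t *: (z - x) = t *: z + (1 - t) *: x.
  by apply/rowP => j; rewrite !mxE; ring.
rewrite -![fine (Gamma _)]/(G _).
have [zxE|/eqP zxN] := eqVneq z x.
  by rewrite zxE combination_same !subrr mulr0.
have := @strict_convexity z x t Dz Dx' zxN; rewrite t0 t1 => /(_ isT).
move: (G _) => w; lra.
Unshelve. all: by end_near. Qed.

Lemma subgradient x y : interior D x -> D y ->
  G x + dot (grad dot Gamma x) (y - x) <= G y.
Proof.
move=> Dx Dy; have [->|/eqP yx] := eqVneq y x.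
  by rewrite subrr dot0r addr0.
by have := strict_subgradient Dx Dy yx; lra.
Qed.

Lemma legendre_ub rho (c : R) : (forall x, D x -> dot x rho - G x <= c) ->
  (legendre dot Gamma rho <= c%:E)%E.
Proof.
move=> hc; apply: ge_ereal_sup => _ [x Dx <-].
by rewrite (dom_fin Dx) -EFinB lee_fin hc.
Qed.

Lemma legendre_lb rho x : D x -> ((dot x rho - G x)%:E <= legendre dot Gamma rho)%E.
Proof.
move=> Dx; apply: ereal_sup_ubound; exists x => //.
by rewrite (dom_fin Dx) -EFinB.
Qed.

(** This is where strict convexity of the conjugate enters, as steepness of
    [Gamma] at the boundary: an affine minorant which is exact at [p] in the limit
    remains one when its slope is moved along a normal [w] to the domain at [p].
    Hence the conjugate would be affine on the half-line from [rho] in direction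
    [w].  The conclusion is used in the form: bounded iterates with bounded
    gradients cannot accumulate at the boundary. *)
Lemma minorant_point_interior x0 p (c : R) rho : interior D x0 ->
    (forall e, 0 < e -> exists x, [/\ D x, `|x - p| < e & G x < c + e]) ->
    (forall x, D x -> c + dot rho (x - p) <= G x) ->
  interior D p.
Proof.
move=> Dx0 near_p minor; apply: contrapT => Dp.
have [w w0 wD] := supporting_normal dot dom_convex Dx0 Dp.
have [K K0 dotK] := dot_bounded dot.
have value (t : R) : 0 <= t ->
    legendre dot Gamma (rho + t *: w) = (dot p (rho + t *: w) - c)%:E.
  move=> t0; apply/eqP; rewrite eq_le; apply/andP; split.
    apply: legendre_ub => x Dx; have := minor x Dx; have := wD x Dx.
    rewrite !dotDr !dotZr !dotNr (dotC _ rho) (dotC _ rho p).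
    rewrite (dotC _ w) (dotC _ w p) => wx.
    have : t * (dot x w - dot p w) <= 0 by rewrite mulr_ge0_le0.
    lra.
  apply/lee_addgt0Pr => e e0.
  (* A point of [D] within [e / 2 / M] of [p] pairs with the slope as [p] does, up
     to [e / 2]; the value of [G] costs the other half. *)
  pose M := K * `|rho + t *: w| + 1.
  have M1 : 1 <= M by rewrite lerDr mulr_ge0// ltW.
  have M0 : 0 < M by lra.
  have d0 : 0 < e / 2 / M by rewrite !divr_gt0.
  have [x [Dx xp Gx]] := near_p _ d0.
  apply: (@le_trans _ _ ((dot x (rho + t *: w) - G x)%:E + e%:E)%E); last first.
    by rewrite leeD2r// legendre_lb.
  rewrite -EFinD lee_fin.
  have := dotK (x - p) (rho + t *: w); rewrite dotBl => /ler_normlP[h1 h2].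
  have h3 : K * (`|x - p| * `|rho + t *: w|) <= e / 2.
    rewrite mulrCA; apply: (@le_trans _ _ (e / 2 / M * M)); last first.
      by rewrite divfK// gt_eqF.
    apply: ler_pM => //; [by rewrite mulr_ge0// ltW|exact: ltW|by rewrite /M; lra].
  have h4 : e / 2 / M <= e / 2 by rewrite ler_pdivrMr// ler_peMr//; lra.
  lra.
have [_ _ _ sL _] := genG.
have domL (t : R) : 0 <= t -> dom (legendre dot Gamma) (rho + t *: w).
  by move=> t0; split => //; rewrite value.
have ne : rho + 0 *: w <> rho + 1 *: w.
  rewrite scale0r scale1r => /addrI /esym /eqP; exact/negP.
have := sL _ _ (2^-1) (domL 0 (lexx _)) (domL 1 ler01) ne.
have -> : 2^-1 *: (rho + 0 *: w) + (1 - 2^-1) *: (rho + 1 *: w) = rho + 2^-1 *: w.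
  by apply/rowP => j; rewrite !mxE; field.
have half : 0 < (2^-1 : R) < 1 by apply/andP; split; lra.
have half0 : 0 <= (2^-1 : R) by lra.
move=> /(_ half); rewrite (value _ half0) (value _ (lexx 0)) (value _ ler01).
rewrite -!EFinM -EFinD lte_fin !dotDr !dotZr; lra.
Qed.

End BregmanGenerator.

(** * Inverting the gradient of the generator *)

Section LegendreGradient.
Context {R : realType} {n : nat} (dot : {dot 'rV[R]_n for idfun}).
Context (Gamma : 'rV[R]_n -> \bar R).
Hypothesis genG : bregman_generator dot Gamma.
Implicit Types x y h p rho : 'rV[R]_n.
Let D := dom Gamma.
Let G := fine \o Gamma.

Lemma generator_continuous x : interior D x ->
  {for x, continuous G} /\ {for x, continuous (grad dot Gamma)}.
Proof.
move=> Dx; have [_ _ smG _ _] := genG; have [dG cg] := smG x Dx; split=> //.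
exact: differentiable_continuous.
Qed.

(** Points that almost attain the supremum at [rho] stay bounded, since [rho] is
    interior to the domain of the conjugate.  A limit of them is a subgradient of
    the conjugate at [rho], hence its gradient; the affine function of slope [rho]
    that is exact there in the limit minorizes [Gamma], so the limit is interior
    and has gradient [rho]. *)
Lemma grad_legendre x0 rho : interior D x0 ->
    interior (dom (legendre dot Gamma)) rho ->
  interior D (grad dot (legendre dot Gamma) rho) /\
  grad dot Gamma (grad dot (legendre dot Gamma) rho) = rho.
Proof.
move=> Dx0 Lrho; set L := legendre dot Gamma in Lrho *.
have [_ _ smG _ smL] := genG.
have Dx0' : D x0 by exact: interior_subset.
have Lfin s : dom L s -> L s = (fine (L s))%:E.
  move=> [_ Ls]; rewrite fineK// fin_numE; apply/andP; split; apply/eqP => //.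
  by move=> Ls'; have := legendre_lb genG s Dx0'; rewrite -/L Ls'.
have Lrho' : dom L rho by exact: interior_subset.
have fenchel s x : dom L s -> D x -> dot x s - G x <= fine (L s).
  by move=> Ls Dx; rewrite -lee_fin -Lfin//; exact: (legendre_lb genG).
have /choice[x xP] : forall k : nat, exists x, D x /\
    G x <= dot x rho - fine (L rho) + k.+1%:R^-1.
  move=> k; have k0 : (0 : R) < k.+1%:R^-1 by rewrite invr_gt0.
  have Lf : ereal_sup [set ((dot y rho)%:E - Gamma y)%E | y in D] \is a fin_num.
    by rewrite -/(legendre dot Gamma rho) -/L Lfin.
  have [_ [y Dy <-]] := ub_ereal_sup_adherent k0 Lf.
  rewrite -/(legendre dot Gamma rho) -/L Lfin// (dom_fin genG Dy) -!EFinB lte_fin.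
  rewrite ltrBlDr addrAC ltrBrDr -ltrBrDl addrAC => /ltW Gy.
  by exists y.
have [U [UU ooU]] := nat_ultrafilter.
have PU : ProperFilter U by exact: ultra_proper.
have [C _ xC] : exists2 C, 0 <= C & forall k, setT k -> `|x k| <= C.
  apply: (weakly_bounded (dot := dot)) => h.
  near (0 : R)^'+ => t.
  have t0 : 0 < t by near: t; exact: nbhs_right_gt.
  have Lt : dom L (rho + t *: h) by near: t; exact: near_line.
  exists ((fine (L (rho + t *: h)) - fine (L rho) + 1) / t) => k _.
  have [Dx xk] := xP k; have := fenchel _ _ Lt Dx.
  rewrite dotDr dotZr ler_pdivlMr// => h1.
  have k1 : (k.+1%:R^-1 : R) <= 1 by rewrite invf_le1// ler1n.
  move: (k.+1%:R^-1 : R) xk k1 => c xk k1; lra.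
have [q qE] : exists q : 'rV[R]_n, x k @[k --> U] --> q.
  by apply: (ultra_cvg_rV (C := C)); apply: nearW => k; exact: xC.
have c0 : (k.+1%:R^-1 : R) @[k --> U] --> (0 : R).
  by apply: cvg_trans (@cvg_harmonic R); exact: cvg_app.
have qsub s : dom L s -> dot q s - dot q rho <= fine (L s) - fine (L rho).
  move=> Ls.
  have := ler_cvg_to (cvgB (cvg_dot (dot := dot) qE (cvg_cst s))
    (cvg_dot (dot := dot) qE (cvg_cst rho)))
    (cvgD (cvg_cst (fine (L s) - fine (L rho))) c0).
  rewrite addr0; apply; apply: nearW => k /=.
  have [Dx xk] := xP k; have := fenchel _ _ Ls Dx.
  rewrite !fctE /=; move: (k.+1%:R^-1 : R) xk => c; lra.
have qgrad : q = grad dot L rho.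
  apply: (dot_le_eq (dot := dot)) => h; apply: (le_grad smL) => //.
  near=> t; have Lt : dom L (rho + t *: h) by near: t; exact: near_line.
  by have := qsub _ Lt; rewrite dotDr dotZr addrAC subrr add0r.
rewrite -qgrad.
pose c := dot q rho - fine (L rho).
have minor y : D y -> c + dot rho (y - q) <= G y.
  move=> Dy; have := fenchel _ _ Lrho' Dy.
  rewrite /c dotDr dotNr (dotC _ rho) (dotC _ rho); lra.
have cE : dot (x k) rho - fine (L rho) + k.+1%:R^-1 @[k --> U] --> c.
  rewrite -[X in _ --> X]addr0 /c.
  apply: cvgD => //; apply: cvgB (cvg_cst _).
  by apply: cvg_dot => //; exact: cvg_cst.
have Dq : interior D q.
  apply: (minorant_point_interior genG Dx0 _ minor) => e e0.
  near U => k; exists (x k); have [Dx xk] := xP k; split => //.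
    by rewrite distrC; near: k; move/cvgrPdist_lt : qE; apply.
  apply: (@le_lt_trans _ _ (dot (x k) rho - fine (L rho) + k.+1%:R^-1)).
    exact: xk.
  by near: k; apply: (cvgr_lt _ cE); lra.
split; first exact: Dq.
apply/esym; apply: (dot_le_eq (dot := dot)) => h.
apply: (le_grad smG); first exact: Dq.
have [cG _] := generator_continuous Dq.
have Gq : G q <= c.
  apply: (ler_cvg_to (cvg_comp _ _ qE cG) cE); apply: nearW => k /=.
  have [_ xk] := xP k.
  exact: xk.
near=> t; have Dt : D (q + t *: h) by near: t; exact: near_line.
have qt : q + t *: h - q = t *: h by rewrite addrAC subrr add0r.
have := minor _ Dt; rewrite qt dotZr.
move: Gq; rewrite /G /=; lra.
Unshelve. all: by end_near. Qed.

End LegendreGradient.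

(** * Proximal points and coercive convex functions *)

Section Admissible.
Context {R : realType} {n : nat} (dot : {dot 'rV[R]_n for idfun}).
Context (Gamma phi : 'rV[R]_n -> \bar R).
Hypothesis genG : bregman_generator dot Gamma.
Hypothesis admphi : admissible dot Gamma phi.
Implicit Types x y h p q : 'rV[R]_n.
Let D := dom Gamma.
Let S := effdom D phi.
Let G := fine \o Gamma.
Let f := fine \o phi.

Lemma effdom_fin x : S x -> phi x = (f x)%:E.
Proof.
move=> [Dx xoo]; have [[noo _] _ _ _ _] := admphi.
by rewrite /f/= fineK// fin_numE; apply/andP; split; apply/eqP => //; exact: noo.
Qed.

Lemma bregman_fin x q : D x -> D q ->
  bregman dot Gamma x q = (G x - G q - dot (grad dot Gamma q) (x - q))%:E.
Proof. by move=> Dx Dq; rewrite /bregman (dom_fin genG Dx) (dom_fin genG Dq). Qed.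

Lemma effdom_convex x y (t : R) : S x -> S y -> 0 < t < 1 ->
  S (t *: x + (1 - t) *: y) /\ f (t *: x + (1 - t) *: y) <= t * f x + (1 - t) * f y.
Proof.
move=> Sx Sy t01; have [_ _ cphi _ _] := admphi.
have [[Dx _] [Dy _]] := (Sx, Sy).
have := cphi x y t Dx Dy t01.
rewrite (effdom_fin Sx) (effdom_fin Sy) -!EFinM -EFinD => le.
have St : S (t *: x + (1 - t) *: y).
  split; first exact: (dom_convex genG).
  by move=> e; rewrite e in le.
by split=> //; rewrite -lee_fin -effdom_fin.
Qed.

(** First-order optimality of the proximal point: it is interior, so the
    differentiable term can be expanded along every segment that issues from it. *)
Lemma prox_subgradient q (p := prox dot Gamma phi q) : interior D q ->
  [/\ interior D p, S p & forall x, S x ->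
    f p + dot (grad dot Gamma q - grad dot Gamma p) (x - p) <= f x].
Proof.
move=> Dq; have [[_ [x1 Sx1]] _ _ _ /(_ q Dq)[p' Dp' argp]] := admphi.
have Dq' : D q by exact: interior_subset.
have pE : p = p' by rewrite /p /prox argp; apply: xget_unique.
have {p' pE argp Dp'} [Dp [_ pmin]] : interior D p /\ prox_argmin dot Gamma phi q p.
  by rewrite argp pE.
clearbody p.
have Dp' : D p by exact: interior_subset.
have Sp : S p.
  split=> // poo; have [Dx1 _] := Sx1; have := pmin _ Dx1.
  by rewrite !bregman_fin// poo (effdom_fin Sx1).
split=> // x Sx; have [_ _ smG _ _] := genG.
suff : f p - f x + dot (grad dot Gamma q) (x - p) <= dot (grad dot Gamma p) (x - p).
  move: (grad dot Gamma q) (grad dot Gamma p) => gq gp.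
  by rewrite dotBl; lra.
apply: (le_grad smG) => //; near=> t.
have t0 : 0 < t by near: t; exact: nbhs_right_gt.
have t1 : t < 1 by near: t; exact: nbhs_right_lt.
have t01 : 0 < t < 1 by rewrite t0.
have [[Dt St] ft] := effdom_convex Sx Sp t01.
have := pmin _ Dt.
rewrite !bregman_fin// (effdom_fin Sp) (effdom_fin (conj Dt St)) -!EFinD lee_fin.
have -> : t *: x + (1 - t) *: p - q = t *: (x - p) + (p - q).
  by apply/rowP => j; rewrite !mxE; ring.
move: ft; have -> : t *: x + (1 - t) *: p = p + t *: (x - p).
  by apply/rowP => j; rewrite !mxE; ring.
move: (grad dot Gamma q) => gq.
rewrite !dotDr !dotZr !dotDr !dotNr /G /f /=; lra.
Unshelve. all: by end_near. Qed.

(** Convexity turns coercivity into linear growth: beyond a sphere around [x0] on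
    which [f] exceeds [f x0 + 1], its slope from [x0] is at least the inverse of
    the radius. *)
Lemma linear_growth x0 : S x0 -> exists2 c, 0 < c & exists r, forall x, S x ->
  r < `|x - x0| -> f x0 + c * `|x - x0| <= f x.
Proof.
move=> Sx0; have [_ _ _ co _] := admphi.
have [r0 r0P] := co (f x0 + 1).
pose r := Num.max r0 0 + `|x0| + 1.
have r_gt0 : 0 < r.
  have m0 : 0 <= Num.max r0 0 by rewrite le_max lexx orbT.
  by rewrite /r ltr_wpDl// addr_ge0.
exists r^-1; first by rewrite invr_gt0.
exists r => x Sx rx.
have x0' : 0 < `|x - x0| by exact: lt_trans rx.
pose t := r / `|x - x0|.
have t01 : 0 < t < 1 by rewrite divr_gt0//= ltr_pdivrMr// mul1r.
have [[Dt St] ft] := effdom_convex Sx Sx0 t01.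
have : f x0 + 1 < f (t *: x + (1 - t) *: x0).
  rewrite -lte_fin -effdom_fin//; apply: r0P => //.
  have e : t *: x + (1 - t) *: x0 = t *: (x - x0) + x0.
    by apply/rowP => j; rewrite !mxE; ring.
  have nt : `|t *: (x - x0)| = r.
    by rewrite normrZ gtr0_norm ?divfK ?gt_eqF//; case/andP: t01.
  have := lerB_normD (t *: (x - x0)) x0; rewrite nt -e; apply: lt_le_trans.
  have : r0 <= Num.max r0 0 by rewrite le_max lexx.
  by rewrite /r; lra.
move=> /lt_le_trans /(_ ft) h.
have t0 : 0 < t by case/andP: t01.
have -> : r^-1 * `|x - x0| = t^-1 by rewrite /t invf_div mulrC.
have : 1 < t * (f x - f x0) by lra.
by rewrite mulrC -ltr_pdivrMr// div1r; lra.
Qed.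

Lemma effdom_lsc x (a : R) : D x -> (S x -> a < f x) ->
  \forall y \near x, S y -> a < f y.
Proof.
move=> Dx ax; have [_ lphi _ _ _] := admphi.
have aphi : (a%:E < phi x)%E.
  have [xoo|xoo] := pselect (phi x = +oo%E); first by rewrite xoo ltry.
  have Sx : S x by [].
  by rewrite effdom_fin// lte_fin ax.
have [V] := lphi x a aphi.
rewrite {1}/nbhs/= -(nbhs_subspace_in Dx) => xV Va.
have {}xV : \forall y \near x, D y -> V y by exact: xV.
near=> y => Sy; have [Dy _] := Sy.
rewrite -lte_fin -effdom_fin//; apply: Va.
by move: Dy; near: y.
Unshelve. all: by end_near. Qed.

End Admissible.

(** * Directions of an affine hull at a relative interior point *)

Section RelativeInterior.
Context {R : realType} {n : nat} (A : set 'rV[R]_n) (x0 : 'rV[R]_n).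
Hypothesis riA : ri A x0.
Implicit Types x h : 'rV[R]_n.

Definition direction (h : 'rV[R]_n) : Prop := affine_hull A (x0 + h).

Lemma is_affine_hull : is_affine (affine_hull A).
Proof.
move=> x y t Ax Ay B [affB AB].
exact: (affB _ _ t (Ax B (conj affB AB)) (Ay B (conj affB AB))).
Qed.

Lemma sub_affine_hull : A `<=` affine_hull A.
Proof. exact: sub_gen_smallest. Qed.

Lemma direction_sub x : A x -> direction (x - x0).
Proof. by move=> Ax; rewrite /direction addrC subrK; exact: sub_affine_hull. Qed.

Lemma direction0 : direction 0.
Proof. by rewrite -(subrr x0); apply: direction_sub; case: riA. Qed.

Lemma directionZ (a : R) h : direction h -> direction (a *: h).
Proof.
rewrite /direction => Ah.
have := is_affine_hull a Ah direction0; rewrite addr0.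
by congr affine_hull; apply/rowP => j; rewrite !mxE; ring.
Qed.

Lemma directionD h k : direction h -> direction k -> direction (h + k).
Proof.
move=> Lh Lk; have := is_affine_hull (2^-1) (directionZ 2 Lh) (directionZ 2 Lk).
by congr affine_hull; apply/rowP => j; rewrite !mxE; field.
Qed.

Lemma direction_ri h : direction h -> exists2 s : R, 0 < s & A (x0 + s *: h).
Proof.
move=> Lh; have [_ nA] := riA.
near (0 : R)^'+ => s.
exists s; first by near: s; exact: nbhs_right_gt.
suff : affine_hull A (x0 + s *: h) -> A (x0 + s *: h).
  by apply; exact: directionZ.
by near: s; exact: (near_line (A := [set y | affine_hull A y -> A y])).
Unshelve. all: by end_near. Qed.

(** A set with an interior point has the whole space as affine hull. *)
Lemma ri_interior x : interior A x -> interior A x0.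
Proof.
move=> Ax; have [_ nA] := riA; apply: filterS nA => y; apply.
near (0 : R)^'+ => s.
have s0 : 0 < s by near: s; exact: nbhs_right_gt.
have Ay : A (x + s *: (y - x)) by near: s; exact: near_line.
have := is_affine_hull (s^-1) (sub_affine_hull Ay)
  (sub_affine_hull (interior_subset Ax)).
congr affine_hull; apply/rowP => j; rewrite !mxE; field.
by rewrite gt_eqF.
Unshelve. all: by end_near. Qed.

End RelativeInterior.

(** * Dual ascent and convergence of the iterates *)

(** In this part the functions are real-valued: [G] and [g] stand for the generator and
    its gradient, [f c] for the two convex functions with domains [S c], and
    [L c] for the direction of the affine hull of [S c].  The sequences [p] and [u] are the
    iterates of index at least one, because the initial value of the dual variable
    is not a subgradient at the starting point; [b k] tells which function step
    [k] uses. *)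
Section DykstraConvergence.
Context {R : realType} {n : nat} (dot : {dot 'rV[R]_n for idfun}).
Implicit Types x y h : 'rV[R]_n.
Context (D : set 'rV[R]_n) (G : 'rV[R]_n -> R) (g : 'rV[R]_n -> 'rV[R]_n).
Hypothesis strictG : forall x y, interior D x -> D y -> y <> x ->
  dot (g x) (y - x) < G y - G x.
Hypothesis contG : forall x, interior D x -> {for x, continuous G}.
Hypothesis contg : forall x, interior D x -> {for x, continuous g}.
Hypothesis steep : forall x (c : R) y,
  (forall e : R, 0 < e -> exists z, [/\ D z, `|z - x| < e & G z < c + e]) ->
  (forall z, D z -> c + dot y (z - x) <= G z) -> interior D x.
Context (S L : bool -> set 'rV[R]_n) (f : bool -> 'rV[R]_n -> R) (x0 : 'rV[R]_n).
Hypothesis Dx0 : interior D x0.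
Hypothesis Sx0 : forall c, S c x0.
Hypothesis lscf : forall c x (a : R), D x -> (S c x -> a < f c x) ->
  \forall y \near x, S c y -> a < f c y.
Hypothesis growth : forall c, exists2 r : R, 0 < r & exists r1, forall x, S c x ->
  r1 < `|x - x0| -> f c x0 + r * `|x - x0| <= f c x.
Hypothesis L0 : forall c, L c 0.
Hypothesis LD : forall c x y, L c x -> L c y -> L c (x + y).
Hypothesis LZ : forall c (a : R) x, L c x -> L c (a *: x).
Hypothesis SL : forall c x, S c x -> L c (x - x0).
Hypothesis LS : forall c h, L c h -> exists2 s : R, 0 < s & S c (x0 + s *: h).
Context (b : nat -> bool) (p u : nat -> 'rV[R]_n) (eta : 'rV[R]_n).
Hypothesis bS : forall k, b k.+1 = ~~ b k.
Hypothesis Dp : forall k, interior D (p k).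
Hypothesis Sp : forall k, S (b k) (p k).
Hypothesis subf : forall k x, S (b k) x ->
  f (b k) (p k) + dot (u k) (x - p k) <= f (b k) x.
Hypothesis etaE : forall k, g (p k.+1) + u k.+1 + u k = eta.
Hypothesis preimage : forall k, exists2 q, interior D q & g q = eta - u k.

Let Dp' k : D (p k). Proof. exact: interior_subset. Qed.
Let Dx0' : D x0. Proof. exact: interior_subset. Qed.

Let B x y := G x - G y - dot (g y) (x - y).

Let B_ge0 x y : interior D y -> D x -> 0 <= B x y.
Proof.
move=> Dy Dx; rewrite /B; have [->|/eqP xy] := eqVneq x y.
  by rewrite !subrr dot0r subrr.
by have := strictG Dy Dx xy; lra.
Qed.

(** Minus the sum of the three conjugates at [u k.+1], [u k] and
    [eta - u k.+1 - u k = g (p k.+1)], in which each conjugate is replaced by the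
    value at a point that attains it; thus no conjugate has to be defined. *)
Let dual k := G (p k.+1) - dot eta (p k.+1) + f (b k.+1) (p k.+1) + f (b k) (p k)
  + dot (u k) (p k.+1 - p k).

(** Weak duality, with an independent point for each of the three functions.  The
    freedom to move them separately is what yields the bounds on the dual
    variables; the Bregman term is what identifies the limit. *)
Lemma dual_le_primal k x x1 x2 : S (b k.+1) x1 -> S (b k) x2 ->
  dual k + B x (p k.+1) + dot (u k.+1) (x1 - x) + dot (u k) (x2 - x) <=
  f (b k.+1) x1 + f (b k) x2 + (G x - dot eta x).
Proof.
move=> Sx1 Sx2; have := subf Sx1; have := subf Sx2.
rewrite /dual /B -(etaE k) !dotE; lra.
Qed.

(** Step [k.+2] maximizes the dual value in the variable of the function used at
    step [k], and the gain dominates the Bregman divergence of the move. *)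
Lemma dual_increase k : dual k + B (p k.+2) (p k.+1) <= dual k.+1.
Proof.
have S2 : S (b k) (p k.+2) by have := Sp k.+2; rewrite !bS negbK.
have := subf S2; rewrite /dual /B -(etaE k) !bS negbK !dotE; lra.
Qed.

Let bound0 := f true x0 + f false x0 + (G x0 - dot eta x0).

Let f_pair k x : f (b k.+1) x + f (b k) x = f true x + f false x.
Proof. by rewrite bS; case: (b k) => //=; rewrite addrC. Qed.

Lemma dual_bounded k : dual k + B x0 (p k.+1) <= bound0.
Proof.
have := @dual_le_primal k x0 x0 x0 (Sx0 _) (Sx0 _).
by rewrite f_pair !subrr !dot0r !addr0.
Qed.

Lemma dual_mono k : dual 0%N <= dual k.
Proof.
elim: k => // k /le_trans; apply; have := dual_increase k.
by have := B_ge0 (Dp k.+1) (Dp' k.+2); lra.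
Qed.

Lemma bregman_step_cvg0 : B (p k.+2) (p k.+1) @[k --> \oo] --> (0 : R).
Proof.
have dcvg : cvg (dual @ \oo).
  apply: nondecreasing_is_cvgn.
    apply/nondecreasing_seqP => k; have := dual_increase k.
    by have := B_ge0 (Dp k.+1) (Dp' k.+2); lra.
  exists bound0 => _ [k _ <-]; have := dual_bounded k.
  by have := B_ge0 (Dp k.+1) Dx0'; lra.
have /cvg_ex[/= l lE] := dcvg.
have d0 : dual k.+1 - dual k @[k --> \oo] --> (0 : R).
  by rewrite -(subrr l); apply: cvgB => //; rewrite (cvg_shiftS dual).
apply: (squeeze_cvgr _ (cvg_cst 0) d0); apply: nearW => k.
by rewrite B_ge0//=; have := dual_increase k; lra.
Qed.

(** The divergence from the interior point [x0] to the iterates is bounded;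
    comparing with its value at a neighbour of [x0] bounds the gradients in every
    direction. *)
Lemma grad_bounded : exists2 C, 0 <= C & forall k, setT k -> `|g (p k.+1)| <= C.
Proof.
apply: (weakly_bounded (dot := dot)) => h.
near (0 : R)^'+ => s.
have s0 : 0 < s by near: s; exact: nbhs_right_gt.
have Ds : D (x0 + s *: h) by near: s; exact: near_line.
exists ((G (x0 + s *: h) - G x0 + (bound0 - dual 0%N)) / s) => k _.
rewrite ler_pdivlMr//.
have := B_ge0 (Dp k.+1) Ds; have := dual_bounded k; have := dual_mono k.
rewrite /B !dotE !dotZr; lra.
Unshelve. all: by end_near. Qed.

Let sumL : set 'rV[R]_n :=
  [set h | exists h1 h2, [/\ L true h1, L false h2 & h = h1 + h2]].

Let L_sumL c h : L c h -> sumL h.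
Proof.
by case: c => Lh; [exists h, 0|exists 0, h]; rewrite ?addr0 ?add0r; split.
Qed.

(** Here relative interiors matter: [x0] can be moved a little inside [S c] along
    every [h] in [L c]. *)
Lemma own_subgradient_bounded c h : L c h ->
  exists C, forall k, b k = c -> dot (u k) h <= C.
Proof.
move=> /LS [s s0 Ss].
exists ((f c (x0 + s *: h) + f (~~ c) x0 + (G x0 - dot eta x0) - dual 0%N) / s).
move=> k bk; rewrite ler_pdivlMr//.
have := @dual_le_primal k x0 x0 (x0 + s *: h) (Sx0 _); rewrite bk => /(_ Ss).
rewrite bS bk subrr dot0r; have := B_ge0 (Dp k.+1) Dx0'; have := dual_mono k.
rewrite !dotE !dotZr; lra.
Qed.

(** Two consecutive subgradients and a gradient add up to the constant [eta], so
    a direction in which one of the subgradients is bounded also bounds the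
    other. *)
Lemma subgradient_bounded c h : L c h ->
  exists C, forall k, dot (u k.+1) h <= C.
Proof.
move=> Lh; have [C1 C1P] := own_subgradient_bounded Lh.
have LNh : L c (- h) by rewrite -scaleN1r; exact: LZ.
have [C2 C2P] := own_subgradient_bounded LNh.
have [C C0 gC] := grad_bounded; have [K K0 dotK] := dot_bounded dot.
exists (Num.max C1 (dot eta h + C2 + K * (C * `|h|))) => k; rewrite le_max.
have [bk|bk] := eqVneq (b k.+1) c; first by rewrite C1P.
apply/orP; right.
have {}bk : b k = c by move: bk; rewrite bS; case: (b k); case: c {Lh C1P LNh C2P}.
have := C2P _ bk; have : - (K * (C * `|h|)) <= dot (g (p k.+1)) h.
  rewrite lerNl (le_trans (ler_norm _))// normrN (le_trans (dotK _ _))//.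
  by rewrite ler_pM2l// ler_wpM2r// gC.
rewrite -(etaE k) !dotE; lra.
Qed.

(** The dual variables themselves may be unbounded, by opposite amounts orthogonal
    to both affine hulls.  Only their products with vectors of [L true + L false]
    ever matter, and on that space they are represented by bounded vectors. *)
Lemma bounded_representatives : exists t : nat -> 'rV[R]_n,
  (forall k h, sumL h -> dot (t k) h = dot (u k) h) /\
  exists2 C, 0 <= C & forall k, `|t k.+1| <= C.
Proof.
have [||| M MP] := @subspace_projector R n sumL.
- by exists 0, 0; rewrite addr0; split.
- move=> _ _ [x1 [x2 [Lx1 Lx2 ->]]] [y1 [y2 [Ly1 Ly2 ->]]].
  by exists (x1 + y1), (x2 + y2); rewrite addrACA; split=> //; exact: LD.
- move=> a _ [x1 [x2 [Lx1 Lx2 ->]]].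
  by exists (a *: x1), (a *: x2); rewrite scalerDr; split=> //; exact: LZ.
have /choice[t tE] : forall k, exists t, forall h, dot (u k) (h *m M) = dot t h.
  by move=> k; apply: riesz => a x y; rewrite mulmxDl -scalemxAl dotDr dotZr.
exists t; split=> [k h Lh|]; first by rewrite -tE (MP h).2.
have [C C0 tC] : exists2 C, 0 <= C & forall k, setT k -> `|t k.+1| <= C.
  apply: (weakly_bounded (dot := dot)) => h.
  have [h1 [h2 [Lh1 Lh2 hE]]] := (MP h).1.
  have [C1 C1P] := subgradient_bounded Lh1.
  have [C2 C2P] := subgradient_bounded Lh2.
  by exists (C1 + C2) => k _; rewrite -tE hE dotDr lerD.
by exists C => // k; exact: tC.
Qed.

Section AlongUltrafilter.
Context (U : set_system nat).
Hypothesis UU : UltraFilter U.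
Hypothesis ooU : \oo `<=` U.

Lemma ultra_shift : UltraFilter (succn @ U) /\ \oo `<=` succn @ U.
Proof.
split; first exact: fmap_ultra.
move=> A [N _ NA]; apply: ooU; exists N => // k /= Nk; apply: NA => /=.
exact: leqW.
Qed.

(** Each [eta - u m] is a gradient of [G], hence the slope of an affine minorant of
    [G].  Inserted into the sum of the subgradient inequalities of [G] and [f] at
    [p k.+1], it bounds [f] there by a constant plus the product of [u m - u k]
    with [p k.+1 - x0].  When the bounded representatives of [u m] and [u k] are
    close, this is less than the linear growth of [f] unless [p k.+1] stays in a
    fixed ball, and one [m] serves almost all [k] for the ultrafilter. *)
Lemma iterate_cvg : exists x : 'rV[R]_n, p k.+2 @[k --> U] --> x.
Proof.
have PU : ProperFilter U by exact: ultra_proper.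
have [t [tu [C C0 tC]]] := bounded_representatives.
have [K K0 dotK] := dot_bounded dot.
have [tau tauE] : exists tau : 'rV[R]_n, t k.+1 @[k --> U] --> tau.
  by apply: (ultra_cvg_rV (C := C)); apply: nearW.
have [r r0 [r1 rP]] : exists2 r : R, 0 < r & exists r1 : R, forall c x, S c x ->
    r1 < `|x - x0| -> f c x0 + r * `|x - x0| <= f c x.
  have [a a0 [a1 aP]] := growth true; have [d d0 [d1 dP]] := growth false.
  exists (Num.min a d); first by rewrite lt_min a0.
  exists (Num.max a1 d1) => c x Sx; rewrite gt_max => /andP[xa xd].
  case: c Sx => Sx.
    by apply: le_trans (aP x Sx xa); rewrite lerD2l ler_wpM2r// ge_min lexx.
  by apply: le_trans (dP x Sx xd); rewrite lerD2l ler_wpM2r// ge_min lexx orbT.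
(* Two representatives within [e] of their limit differ by at most [r / (2 * K)],
   and so contribute at most half of the growth rate [r]. *)
pose e := r / (4 * K).
have e0 : 0 < e by rewrite divr_gt0// mulr_gt0.
have near_tau : \forall k \near U, `|tau - t k.+1| < e.
  by move/cvgrPdist_lt : tauE; exact.
have [m tm] := filter_ex near_tau.
have [q Dq gq] := preimage m.+1.
have Dq' : D q by exact: interior_subset.
pose Km := - G q - dot (eta - u m.+1) (x0 - q).
pose C' := Num.max r1 (2 * (G x0 + Km) / r).
suff pC : \forall k \near U, `|p k.+2| <= `|x0| + C'.
  by have [x xE] := ultra_cvg_rV pC; exists x.
near=> k.
have tk : `|tau - t k.+1| < e by near: k.
have -> : p k.+2 = x0 + (p k.+2 - x0) by rewrite addrC subrK.
rewrite (le_trans (ler_normD _ _))// lerD2l.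
set h := p k.+2 - x0.
rewrite leNgt; apply/negP; rewrite gt_max => /andP[r1h hbig].
have := rP _ _ (Sp k.+2) r1h; rewrite -/h => grow.
have Lh : sumL h by exact: L_sumL (SL (Sp k.+2)).
have le1 := subf (Sx0 (b k.+2)).
have le2 := B_ge0 (Dp k.+2) Dx0'.
have le3 := B_ge0 Dq (Dp' k.+2).
have tt : dot (t m.+1 - t k.+1) h <= r / 2 * `|h|.
  rewrite (le_trans (ler_norm _))// (le_trans (dotK _ _))// mulrA ler_wpM2r//.
  have : `|t m.+1 - t k.+1| <= 2 * e.
    have -> : t m.+1 - t k.+1 = (tau - t k.+1) - (tau - t m.+1).
      by apply/rowP => j; rewrite !mxE; ring.
    by rewrite (le_trans (ler_normB _ _))//; lra.
  move=> /(ler_wpM2l (ltW K0)) /le_trans; apply.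
  by rewrite /e le_eqVlt; apply/orP; left; apply/eqP; field; rewrite gt_eqF.
rewrite dotBl !tu// in tt.
have hx : p k.+2 = h + x0 by rewrite subrK.
have : f (b k.+2) (p k.+2) <= f (b k.+2) x0 + (G x0 + Km) + r / 2 * `|h|.
  move: le1 le2 le3; rewrite /B gq /Km -(etaE k.+1) hx.
  move: tt; rewrite !dotE; lra.
rewrite ltr_pdivrMr// in hbig.
move=> /(le_trans grow); lra.
Unshelve. all: by end_near. Qed.

(** Iterates and gradients are bounded, hence so are the values of [G]; their
    limits define an affine minorant of [G] that is exact at [x] in the limit. *)
Lemma limit_interior x : p k.+2 @[k --> U] --> x -> interior D x.
Proof.
move=> xE; have PU : ProperFilter U by exact: ultra_proper.
have [C C0 gC] := grad_bounded.
have [y yE] : exists y : 'rV[R]_n, g (p k.+2) @[k --> U] --> y.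
  by apply: (ultra_cvg_rV (C := C)); apply: nearW => k; exact: gC.
have lower : dot (g x0) (p k.+2 - x0) + G x0 @[k --> U] --> dot (g x0) (x - x0) + G x0.
  apply: cvgD (cvg_cst _); apply: cvg_dot; first exact: cvg_cst.
  by apply: cvgB => //; exact: cvg_cst.
have upper : G x0 - dot (g (p k.+2)) (x0 - p k.+2) @[k --> U] --> G x0 - dot y (x0 - x).
  apply: cvgB; first exact: cvg_cst.
  by apply: cvg_dot => //; apply: cvgB => //; exact: cvg_cst.
have [c cE] : exists c : R, G (p k.+2) @[k --> U] --> c.
  apply: (ultra_cvg_real (a := dot (g x0) (x - x0) + G x0 - 1)
                         (b := G x0 - dot y (x0 - x) + 1)).
  near=> k.
  have l1 : dot (g x0) (x - x0) + G x0 - 1 < dot (g x0) (p k.+2 - x0) + G x0.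
    by near: k; apply: (cvgr_gt _ lower); lra.
  have l2 : G x0 - dot (g (p k.+2)) (x0 - p k.+2) < G x0 - dot y (x0 - x) + 1.
    by near: k; apply: (cvgr_lt _ upper); lra.
  have := B_ge0 (Dp k.+2) Dx0'; have := B_ge0 Dx0 (Dp' k.+2).
  by rewrite /B => h1 h2; apply/andP; split; lra.
apply: (@steep x c y) => [e e0|z Dz].
  near U => k; exists (p k.+2); split=> //.
    by rewrite distrC; near: k; move/cvgrPdist_lt : xE; exact.
  by near: k; apply: (cvgr_lt _ cE); rewrite ltrDl.
apply: (ler_cvg_to (cvgD cE (cvg_dot (dot := dot) yE (cvgB (cvg_cst z) xE)))
  (cvg_cst (G z))).
apply: nearW => k; have := B_ge0 (Dp k.+2) Dz; rewrite /B !fctE; lra.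
Unshelve. all: by end_near. Qed.

Lemma B_cvg (F : set_system nat) (FF : Filter F) (w z : nat -> 'rV[R]_n) x y :
  interior D x -> interior D y -> w @ F --> x -> z @ F --> y ->
  B (w k) (z k) @[k --> F] --> B x y.
Proof.
move=> Dx Dy wx zy; apply: cvgB.
  by apply: cvgB; [exact: cvg_comp wx (contG Dx)|exact: cvg_comp zy (contG Dy)].
by apply: cvg_dot; [exact: cvg_comp zy (contg Dy)|exact: cvgB].
Qed.

Lemma B_le0_eq x y : interior D y -> D x -> B x y <= 0 -> x = y.
Proof.
move=> Dy Dx; rewrite /B; have [->//|/eqP xy B0] := eqVneq x y.
by exfalso; have := strictG Dy Dx xy; lra.
Qed.

End AlongUltrafilter.

(** The divergence between consecutive iterates tends to zero, and it is
    continuous at interior points. *)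
Lemma limit_step (U : set_system nat) x : UltraFilter U -> \oo `<=` U ->
  p k.+2 @[k --> U] --> x -> p k.+3 @[k --> U] --> x.
Proof.
move=> UU ooU xE; have PU : ProperFilter U by exact: ultra_proper.
have [UU' ooU'] := ultra_shift UU ooU.
have [y yE] := iterate_cvg UU'.
have Dx := limit_interior UU xE; have Dy := limit_interior UU' yE.
have {}yE : p k.+3 @[k --> U] --> y by exact: yE.
have By : B (p k.+3) (p k.+2) @[k --> U] --> B y x by exact: B_cvg.
have B0 : B (p k.+3) (p k.+2) @[k --> U] --> (0 : R).
  have := bregman_step_cvg0.
  rewrite -(cvg_shiftS (fun k => B (p k.+2) (p k.+1))) => B0.
  by apply: cvg_trans B0; exact: cvg_app.
have -> : x = y; last exact: yE.
apply/esym/B_le0_eq => //; first exact: interior_subset.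
by rewrite (cvg_unique _ By B0).
Qed.

(** The subgradient inequality at [x0] bounds [f c] along the iterates, and lower
    semicontinuity keeps the limit in the domain. *)
Lemma limit_effdom (U : set_system nat) x c : UltraFilter U ->
  p k.+2 @[k --> U] --> x -> (\forall k \near U, b k.+2 = c) -> S c x.
Proof.
move=> UU xE bc; have PU : ProperFilter U by exact: ultra_proper.
have Dx := limit_interior UU xE.
have [t [tu [C C0 tC]]] := bounded_representatives.
have [tau tauE] : exists tau : 'rV[R]_n, t k.+2 @[k --> U] --> tau.
  by apply: (ultra_cvg_rV (C := C)); apply: nearW => k; exact: tC.
apply: contrapT => nSx.
pose a := f c x0 + dot tau (x - x0) + 1.
have := @lscf c x a (interior_subset Dx).
move=> /(_ (fun Sx => False_ind _ (nSx Sx))) => lsc.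
have : \forall k \near U, False.
  near=> k.
  have bk : b k.+2 = c by near: k.
  have : S c (p k.+2) -> a < f c (p k.+2) by near: k; exact: (xE _ lsc).
  rewrite -bk => /(_ (Sp _)); rewrite bk.
  have := subf (Sx0 (b k.+2)); rewrite bk.
  have tx : dot (t k.+2) (p k.+2 - x0) < dot tau (x - x0) + 1.
    near: k.
    have c1 : dot (t k.+2) (p k.+2 - x0) @[k --> U] --> dot tau (x - x0).
      by apply: cvg_dot => //; apply: cvgB => //; exact: cvg_cst.
    by apply: (cvgr_lt _ c1); rewrite ltrDl.
  move: tx; rewrite tu; last exact: L_sumL (SL (Sp _)).
  rewrite /a -(opprB (p k.+2) x0) dotNr.
  move: (dot tau (x - x0)) (dot (u k.+2) (p k.+2 - x0)) => *; lra.
by move=> /filter_ex[].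
Unshelve. all: by end_near. Qed.

Let primal x := f true x + f false x + (G x - dot eta x).

(** In the limit weak duality becomes optimality of [x]: the duality gap at [x] is
    the product of a dual variable with the difference of two consecutive iterates,
    which tends to zero once the dual variable is replaced by its bounded
    representative. *)
Lemma limit_optimal (U : set_system nat) x : UltraFilter U -> \oo `<=` U ->
    p k.+2 @[k --> U] --> x ->
  [/\ S true x, S false x &
      forall z, D z -> S true z -> S false z -> primal x + B z x <= primal z].
Proof.
move=> UU ooU xE; have PU : ProperFilter U by exact: ultra_proper.
have xE1 := limit_step UU ooU xE.
have Dx := limit_interior UU xE.
have [UU' ooU'] := ultra_shift UU ooU.
have [c bc] : exists c, \forall k \near U, b k.+2 = c.
  have [b1|b1] := in_ultra_setVsetC [set k | b k.+2] UU.
    by exists true; apply: filterS b1.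
  by exists false; apply: filterS b1 => k /negP/negbTE.
have Scx : S c x by exact: (limit_effdom UU xE bc).
have Sncx : S (~~ c) x.
  apply: (limit_effdom UU' xE1).
  by apply: filterS bc => k /= <-; rewrite bS.
have [St Sf] : S true x /\ S false x by case: (c) Scx Sncx.
split=> // z Dz Stz Sfz.
have Sz d : S d z by case: d.
have fc : f true x + f false x = f (~~ c) x + f c x.
  by case: (c) => //=; rewrite addrC.
have [t [tu [C C0 tC]]] := bounded_representatives.
have [tau tauE] : exists tau : 'rV[R]_n, t k.+2 @[k --> U] --> tau.
  by apply: (ultra_cvg_rV (C := C)); apply: nearW => k; exact: tC.
apply/ler_addgt0Pr => e e0.
have lim : G (p k.+3) - dot eta (p k.+3) + dot (t k.+2) (p k.+3 - p k.+2)
    + B z (p k.+3) @[k --> U] --> G x - dot eta x + 0 + B z x.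
  have Dz' : B z (p k.+3) @[k --> U] --> B z x.
    apply: cvgB.
      by apply: cvgB; [exact: cvg_cst|exact: cvg_comp xE1 (contG Dx)].
    apply: cvg_dot; first exact: cvg_comp xE1 (contg Dx).
    by apply: cvgB => //; exact: cvg_cst.
  apply: cvgD => //; apply: cvgD.
    apply: cvgB; first exact: cvg_comp xE1 (contG Dx).
    by apply: cvg_dot => //; exact: cvg_cst.
  rewrite -[0](dot0r dot tau) -(subrr x).
  by apply: cvg_dot => //; exact: cvgB.
have bound : \forall k \near U, G (p k.+3) - dot eta (p k.+3) +
    dot (t k.+2) (p k.+3 - p k.+2) + B z (p k.+3) <=
    primal z + e - (f true x + f false x).
  have e2 : f c x - e / 2 < f c x by lra.
  have e3 : f (~~ c) x - e / 2 < f (~~ c) x by lra.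
  have lsc1 := lscf (interior_subset Dx) (fun _ => e2).
  have lsc2 := lscf (interior_subset Dx) (fun _ => e3).
  near=> k.
  have bk : b k.+2 = c by near: k.
  have : S c (p k.+2) -> f c x - e / 2 < f c (p k.+2) by near: k; exact: (xE _ lsc1).
  rewrite -{1}bk => /(_ (Sp _)) => f2.
  have : S (~~ c) (p k.+3) -> f (~~ c) x - e / 2 < f (~~ c) (p k.+3).
    by near: k; exact: (xE1 _ lsc2).
  rewrite -{1}bk -bS => /(_ (Sp _)) => f3.
  have := @dual_le_primal k.+2 z z z (Sz _) (Sz _).
  rewrite f_pair !subrr !dot0r !addr0 /dual bS bk -/(primal z).
  rewrite tu; last first.
    have -> : p k.+3 - p k.+2 = (p k.+3 - x0) + (-1) *: (p k.+2 - x0).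
      by apply/rowP => j; rewrite !mxE; ring.
    have [] : sumL (p k.+3 - x0) /\ sumL ((-1) *: (p k.+2 - x0)).
      split; first exact: L_sumL (SL (Sp _)).
      by apply: (@L_sumL (b k.+2)); apply: LZ; exact: SL.
    move=> [x1 [x2 [Lx1 Lx2 ->]]] [y1 [y2 [Ly1 Ly2 ->]]].
    by exists (x1 + y1), (x2 + y2); rewrite addrACA; split=> //; exact: LD.
  rewrite fc; move: (primal z) (B z _) => q1 q2; lra.
have := ler_cvg_to lim (cvg_cst _) bound.
move=> /(_ _ _); rewrite /primal; lra.
Unshelve. all: by end_near. Qed.

(** The optimality inequality is strict away from the limit, so the limits along
    all ultrafilters coincide. *)
Lemma iterates_converge : exists x, [/\ interior D x, S true x, S false x,
  p @ \oo --> x &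
  forall z, D z -> S true z -> S false z ->
    f true x + f false x + (G x - dot eta x) + (G z - G x - dot (g x) (z - x)) <=
    f true z + f false z + (G z - dot eta z)].
Proof.
have [U [UU ooU]] := nat_ultrafilter.
have [x xE] := iterate_cvg UU.
have Dx := limit_interior UU xE.
have [Stx Sfx xopt] := limit_optimal UU ooU xE.
exists x; split=> //.
rewrite -(cvg_shiftS p) -(cvg_shiftS (fun k => p k.+1)).
apply: ultra_cvg => V VU ooV.
have [y yE] := iterate_cvg VU.
have Dy := limit_interior VU yE.
have [Sty Sfy yopt] := limit_optimal VU ooV yE.
have -> : x = y; last exact: yE.
apply: B_le0_eq => //; first exact: interior_subset.
have := xopt y (interior_subset Dy) Sty Sfy.
have := yopt x (interior_subset Dx) Stx Sfx.
have := B_ge0 Dx (interior_subset Dy).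
move: (primal x) (primal y) (B x y) (B y x) => q1 q2 q3 q4; lra.
Qed.

End DykstraConvergence.

(** * Convergence of the proximal iteration *)

Lemma objective_effdom {R : realType} {n : nat}
    (dot : {dot 'rV[R]_n for idfun}) (Gamma phi1 phi2 : 'rV[R]_n -> \bar R) xi x :
    bregman_generator dot Gamma -> dom Gamma xi ->
    admissible dot Gamma phi1 -> admissible dot Gamma phi2 ->
    dom Gamma x -> (bregman dot Gamma x xi + phi1 x + phi2 x < +oo)%E ->
  effdom (dom Gamma) phi1 x /\ effdom (dom Gamma) phi2 x.
Proof.
move=> genG Dxi [[noo1 _] _ _ _ _] [[noo2 _] _ _ _ _] Dx.
have n1 := noo1 _ Dx; have n2 := noo2 _ Dx.
rewrite (bregman_fin genG)// => lt.
split; split=> // e; move: lt; rewrite e.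
  by case: (phi2 x) n2 => [s||] n2 //; rewrite ltxx.
by case: (phi1 x) n1 => [s||] n1 //; rewrite ltxx.
Qed.

Lemma objective_fin {R : realType} {n : nat}
    (dot : {dot 'rV[R]_n for idfun}) (Gamma phi1 phi2 : 'rV[R]_n -> \bar R) xi x :
    bregman_generator dot Gamma -> dom Gamma xi ->
    admissible dot Gamma phi1 -> admissible dot Gamma phi2 ->
    effdom (dom Gamma) phi1 x -> effdom (dom Gamma) phi2 x ->
  (bregman dot Gamma x xi + phi1 x + phi2 x)%E =
  (fine (phi1 x) + fine (phi2 x) + (fine (Gamma x) - dot (grad dot Gamma xi) x)
    + (dot (grad dot Gamma xi) xi - fine (Gamma xi)))%:E.
Proof.
move=> genG Dxi adm1 adm2 S1 S2; have [Dx _] := S1.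
rewrite (bregman_fin genG)// (effdom_fin adm1 S1) (effdom_fin adm2 S2) -!EFinD.
by congr (_%:E); rewrite dotBr /=; ring.
Qed.

Theorem proposition3p1 (R : realType) (n : nat)
    (dot : {dot 'rV[R]_n for idfun})
    (Gamma phi1 phi2 : 'rV[R]_n -> \bar R) (xi : 'rV[R]_n)
    (pi : nat -> 'rV[R]_n) (v : int -> 'rV[R]_n)
    (hGamma : bregman_generator dot Gamma)
    (hxi : interior (dom Gamma) xi)
    (hphi1 : admissible dot Gamma phi1)
    (hphi2 : admissible dot Gamma phi2)
    (hri : (ri (effdom (dom Gamma) phi1) `&` ri (effdom (dom Gamma) phi2)
            `&` ri (dom Gamma)) !=set0)
    (hpi0 : pi 0%N = xi) (hv0 : v 0 = 0) (hvN1 : v (-1) = 0)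
    (* the gradient of [legendre dot Gamma] is taken where it exists *)
    (hdef : forall l : nat, (0 < l)%N ->
       interior (dom (legendre dot Gamma))
         (grad dot Gamma (pi l.-1) + v (l%:Z - 2)))
    (hpi : forall l : nat, (0 < l)%N ->
       pi l = prox dot Gamma (if odd l then phi1 else phi2)
                (grad dot (legendre dot Gamma)
                   (grad dot Gamma (pi l.-1) + v (l%:Z - 2))))
    (hv : forall l : nat, (0 < l)%N ->
       v l%:Z = v (l%:Z - 2) + grad dot Gamma (pi l.-1)
                - grad dot Gamma (pi l)) :
  exists pibar : 'rV[R]_n,
    argmin (dom Gamma)
      (fun p => bregman dot Gamma p xi + phi1 p + phi2 p)%E = [set pibar] /\
    pi @ \oo --> pibar.
Proof.
have [x0 [[ri1 ri2] riD]] := hri.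
pose phi (c : bool) := if c then phi1 else phi2.
have adm c : admissible dot Gamma (phi c) by case: c.
pose S c := effdom (dom Gamma) (phi c).
have riS c : ri (S c) x0 by case: c.
have Dx0 := ri_interior riD hxi.
have shift1 (l : nat) : l.+1%:Z - 2 = l%:Z - 1 by rewrite -addn1 PoszD -addrA.
pose q l := grad dot (legendre dot Gamma) (grad dot Gamma (pi l) + v (l.+1%:Z - 2)).
have qP l := grad_legendre hGamma Dx0 (hdef l.+1 (ltn0Sn l)).
have step l : [/\ interior (dom Gamma) (pi l.+1), S (odd l.+1) (pi l.+1) &
    forall x, S (odd l.+1) x ->
      fine (phi (odd l.+1) (pi l.+1)) + dot (v l.+1) (x - pi l.+1) <=
      fine (phi (odd l.+1) x)].
  have [Dq gq] := qP l.
  have := prox_subgradient hGamma (adm (odd l.+1)) Dq.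
  rewrite gq -(hpi _ (ltn0Sn l)) => -[Dp Sp sub]; split=> // x Sx.
  have -> : v l.+1%:Z = grad dot Gamma (pi l) + v (l.+1%:Z - 2)
      - grad dot Gamma (pi l.+1) by rewrite hv//= (addrC (v _)).
  exact: sub.
(* The gradient at the current iterate and the two current dual variables add up
   to the gradient at [xi]. *)
have invariant l : grad dot Gamma (pi l) + v l%:Z + v (l%:Z - 1) = grad dot Gamma xi.
  elim: l => [|l <-]; first by rewrite hpi0 hv0 sub0r hvN1 !addr0.
  rewrite (hv l.+1)// shift1 /=.
  have -> : l.+1%:Z - 1 = l%:Z by rewrite -addn1 PoszD addrK.
  move: (grad dot Gamma (pi l)) (grad dot Gamma (pi l.+1)) => y y'.
  by apply/rowP => j; rewrite !mxE; ring.
have etaE k : grad dot Gamma (pi k.+2) + v k.+2%:Z + v k.+1%:Z = grad dot Gamma xi.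
  have := invariant k.+2.
  have -> : k.+2%:Z - 1 = k.+1%:Z by rewrite -addn1 PoszD addrK.
  by [].
have preimage k : exists2 z, interior (dom Gamma) z &
    grad dot Gamma z = grad dot Gamma xi - v k.+1%:Z.
  have [Dq gq] := qP k.+1; exists (q k.+1); first exact: Dq.
  rewrite gq -(invariant k.+1) shift1.
  by rewrite [in RHS]addrAC addrK.
have [x [Dx S1x S2x pix xmin]] := iterates_converge (dot := dot) (D := dom Gamma)
  (G := fine \o Gamma) (g := grad dot Gamma)
  (strict_subgradient hGamma)
  (fun x Dx => (generator_continuous hGamma Dx).1)
  (fun x Dx => (generator_continuous hGamma Dx).2)
  (fun x c y => minorant_point_interior hGamma Dx0)
  Dx0 (fun c => (riS c).1)
  (fun c => effdom_lsc (adm c))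
  (fun c => linear_growth hGamma (adm c) (riS c).1)
  (fun c => direction0 (riS c))
  (fun c => directionD (riS c))
  (fun c => directionZ (riS c))
  (fun c => @direction_sub _ _ (S c) x0)
  (fun c => direction_ri (riS c))
  (b := fun k => odd k.+1) (p := fun k => pi k.+1) (u := fun k => v k.+1%:Z)
  (eta := grad dot Gamma xi)
  (fun k => erefl)
  (fun k => let: And3 h _ _ := step k in h)
  (fun k => let: And3 _ h _ := step k in h)
  (fun k => let: And3 _ _ h := step k in h)
  etaE preimage.
have Dxi := interior_subset hxi.
have Dx' := interior_subset Dx.
exists x; split; last by rewrite -(cvg_shiftS pi).
apply/seteqP; split=> z /=.
  move=> [Dz /(_ x Dx')]; rewrite (objective_fin hGamma Dxi hphi1 hphi2 S1x S2x).
  move=> zx.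
  have [S1z S2z] := objective_effdom hGamma Dxi hphi1 hphi2 Dz
    (le_lt_trans zx (ltry _)).
  move: zx; rewrite (objective_fin hGamma Dxi hphi1 hphi2 S1z S2z) lee_fin lerD2r.
  have := xmin z Dz S1z S2z; have [//|/eqP zx] := eqVneq z x.
  have := strict_subgradient hGamma Dx Dz zx.
  rewrite /phi/=; move: (grad dot Gamma xi) (grad dot Gamma x) => g1 g2.
  by rewrite ltNge => /negP lt1 le1 le2; case: lt1; lra.
move=> ->; split=> // y Dy.
rewrite (objective_fin hGamma Dxi hphi1 hphi2 S1x S2x).
rewrite leNgt; apply/negP => yx.
have [S1y S2y] := objective_effdom hGamma Dxi hphi1 hphi2 Dy (lt_trans yx (ltry _)).
move: yx; rewrite (objective_fin hGamma Dxi hphi1 hphi2 S1y S2y) lte_fin ltrD2r.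
have := xmin y Dy S1y S2y; have := subgradient hGamma Dx Dy.
rewrite /phi/=; move: (grad dot Gamma xi) (grad dot Gamma x) => g1 g2.
by move=> le1 le2; rewrite ltNge => /negP; apply; lra.
Qed.
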